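(* Let $(X,d)$ be an unbounded metric space, $p\in X$, and let $n\ge 2$ be an integer. Define $F_n\colon X^n\to\mathbb{R}$ by $$F_n(x_1,\ldots,x_n):=\frac{\min\limits_{1\le k\le n} d(x_k,p)\ \prod\limits_{1\le k<l\le n} d(x_k,x_l)}{\left(\max\limits_{1\le k\le n} d(x_k,p)\right)^{\frac{n(n-1)}{2}+1}}\quad\text{if }(x_1,\ldots,x_n)\ne(p,\ldots,p),$$ and $F_n(p,\ldots,p):=0$. Then the inequality $$|V(G_{X,\tilde r})|\le n$$ holds for every scaling sequence $\tilde r$ if and only if both of the following hold: $$\lim_{x_1,\ldots,x_n\to\infty}F_n(x_1,\ldots,x_n)=0$$ (that is, for every $\varepsilon>0$ there is $R>0$ such that $F_n(x_1,\ldots,x_n)<\varepsilon$ whenever $x_1,\dots,x_n\in X$ satisfy $d(x_i,p)>R$ for all $i$), and $$\lim_{k\to 1,\ k>1}\ \limsup_{r\to\infty}\frac{\operatorname{diam}(A(p,r,k))}{r}=\lim_{r\to\infty}\frac{\operatorname{diam}(S(p,r))}{r}=0,$$ where $r\in(0,\infty)$ and $k\in[1,\infty)$.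
   Context: A scaling sequence is a sequence $\tilde r=(r_n)_{n\in\mathbb{N}}$ of positive real numbers with $\lim_{n\to\infty}r_n=\infty$. Let $(X,d)$ be an unbounded metric space and $p\in X$ (the notions below do not depend on the choice of $p$). $Seq(X,\tilde r)$ is the set of all sequences $\tilde x=(x_n)_{n\in\mathbb{N}}$ of points of $X$ such that $\lim_{n\to\infty}d(x_n,p)=\infty$ and the finite limit $\lim_{n\to\infty}d(x_n,p)/r_n$ exists. On $Seq(X,\tilde r)$ define the equivalence relation $\tilde x\equiv\tilde y$ iff $\lim_{n\to\infty}d(x_n,y_n)/r_n=0$. The graph $G_{X,\tilde r}$ (the cluster of pretangent spaces) has as vertex set $V(G_{X,\tilde r})$ the set of all $\equiv$-equivalence classes of $Seq(X,\tilde r)$; two distinct vertices $u,v$ are adjacent iff $\lim_{n\to\infty}d(x_n,y_n)/r_n$ exists for $\tilde x\in u$, $\tilde y\in v$. For $r>0$ and $k\ge1$: $A(p,r,k):=\{x\in X:\ r/k\le d(x,p)\le rk\}$ and $S(p,r):=\{x\in X:\ d(x,p)=r\}$. Convention: $\operatorname{diam}(\varnothing)=0$. *)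

(* Defs.v *)
From mathcomp Require Import all_boot all_order all_algebra.
From mathcomp Require Import all_classical all_reals all_analysis.
Import Order.TTheory GRing.Theory Num.Theory.
Import numFieldNormedType.Exports.

Set Implicit Arguments.
Unset Strict Implicit.
Unset Printing Implicit Defensive.

Local Open Scope classical_set_scope.
Local Open Scope ring_scope.

Definition unbounded_space (R : realType) (X : metricType R) : Prop :=
  forall M : R, exists x y : X, M < mdist x y.

Definition scaling_sequence (R : realType) (r : nat -> R) : Prop :=
  (forall n, 0 < r n) /\ r n @[n --> \oo] --> +oo.

Definition Seq (R : realType) (X : metricType R) (p : X) (r : nat -> R) :
    set (nat -> X) :=
  [set x | mdist (x n) p @[n --> \oo] --> +oo /\
           cvgn (fun n => mdist (x n) p / r n)].

Definition Seq_equiv (R : realType) (X : metricType R) (r : nat -> R)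
    (x y : nat -> X) : Prop :=
  mdist (x n) (y n) / r n @[n --> \oo] --> (0 : R).

Record graph (T : Type) := Graph {
  vertices : set T;
  adjacent : T -> T -> Prop }.

(* The vertices are the equivalence classes themselves, as sets of sequences.
   Whether mdist (x n) (y n) / r n converges does not depend on the
   representatives x and y of two classes. *)
Definition pretangent_cluster (R : realType) (X : metricType R) (p : X) (r : nat -> R) :
    graph (set (nat -> X)) :=
  let V := [set [set y | Seq p r y /\ Seq_equiv r x y] | x in Seq p r] in
  {| vertices := V;
     adjacent := fun u v => [/\ V u, V v, u <> v &
       forall x y, u x -> v y -> cvgn (fun n => mdist (x n) (y n) / r n)] |}.

Definition annulus (R : realType) (X : metricType R) (p : X) (r k : R) :
    set X :=
  [set x | r / k <= mdist x p <= r * k].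

Definition sphere (R : realType) (X : metricType R) (p : X) (r : R) : set X :=
  [set x | mdist x p = r].

(* The added 0 only matters for the empty set: ereal_sup set0 = -oo. *)
Definition diam (R : realType) (X : metricType R) (A : set X) : \bar R :=
  ereal_sup (0%E |` [set (mdist x y)%:E | x in A & y in A]).

(* Distances are nonnegative, so 0 is a neutral starting value for the maximum;
   the maximum in turn is one for the minimum. Both are meant for n > 0. *)
Definition max_dist (R : realType) (X : metricType R) (p : X) (n : nat)
    (x : 'I_n -> X) : R :=
  \big[Num.max/0]_(k < n) mdist (x k) p.

Definition min_dist (R : realType) (X : metricType R) (p : X) (n : nat)
    (x : 'I_n -> X) : R :=
  \big[Num.min/max_dist p x]_(k < n) mdist (x k) p.

Definition F_ (R : realType) (X : metricType R) (p : X) (n : nat)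
    (x : 'I_n -> X) : R :=
  if [forall k, x k == p] then 0
  else min_dist p x * (\prod_(k < n) \prod_(l < n | (k < l)%N) mdist (x k) (x l))
       / max_dist p x ^+ (n * (n - 1) %/ 2 + 1).

(* Main.v *)
Require Import Defs.
From mathcomp Require Import all_boot all_order all_algebra.
From mathcomp Require Import all_classical all_reals all_analysis.
Import Order.TTheory GRing.Theory Num.Theory.
Import numFieldNormedType.Exports.

(** Write rho(x) = lim d(x_m, p) / r_m for a sequence x of Seq(X, r).  All
    sequences with rho = 0 are equivalent and form at most one vertex, which
    is present along suitable r because X is unbounded; the other vertices
    have rho > 0.  The condition on the diameters of annuli says, uniformly, that
    rho separates the vertices: it amounts to [thin_annuli], which asks that
    points of a sufficiently thin annulus of large radius r be at distance
    o(r) from each other.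

    Necessity of thin annuli ([thin_annuli_of_card]).  If it fails, there are
    r_m -> oo and points x_m, y_m with d(x_m, p) / r_m and d(y_m, p) / r_m
    tending to 1 but d(x_m, y_m) > e r_m.  Any sequence that picks x_m or y_m
    at each m belongs to Seq(X, r) with rho = 1, and two choices that differ
    infinitely often are inequivalent, so there are infinitely many vertices.
    Spheres lie in annuli, hence their condition follows
    ([thin_annuli_sphere]).

    Necessity of F_n -> 0 ([F_small_of_card]).  With r = max d(x_k, p), the
    value F_n(x_1, ..., x_n) is the product of min d(x_k, p) / r and of the
    numbers d(x_k, x_l) / r, the first at most 1 and the others at most 2
    ([F_normalized]).  So a lower bound on F_n is a lower bound on each factor
    ([F_separation]).  If F_n >= e along tuples going to infinity, take r_m to
    be their maxima and extract a subsequence along which all d(x_k, p) / r_m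
    converge: this gives n pairwise inequivalent sequences with rho > 0, which
    together with the vertex rho = 0 make n + 1 vertices.

    Sufficiency ([card_of_F_small]).  Among n + 1 pairwise inequivalent
    sequences, n have rho > 0; since the annuli are thin, their rho are
    pairwise distinct.  By the triangle inequality their mutual distances are
    then bounded below by a multiple of r_m, and F_n stays away from 0 along
    them ([F_ge]). *)

Local Open Scope classical_set_scope.
Local Open Scope ring_scope.

(** * Counting vertices by inequivalent sequences *)

(** Turns a bound on a cardinal into the absence of n + 1 distinct elements,
    the form in which every vertex count below is proved and used. *)
Lemma card_le_II_injP (T : Type) (A : set T) (n : nat) :
  (A #<= `I_n)%card <->
  ~ exists f : 'I_n.+1 -> T, injective f /\ forall i, A (f i).
Proof.
split=> [leAn [f [finj fA]]|noinj].
  have : ([set: 'I_n.+1] #<= A)%card.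
    rewrite -(card_le_eql (inj_card_eq (A := setT) (in2W finj))).
    by apply: subset_card_le => _ [i _ <-].
  rewrite -(card_le_eql (@card_II n.+1)) => /card_le_trans/(_ leAn).
  by rewrite card_le_II ltnn.
have notle : ~ (`I_n.+1 #<= A)%card.
  rewrite (card_le_eql (@card_II n.+1)) => /card_leP[f].
  apply: noinj; exists (fun i => set_val (f (SigSub (mem_setT i)))).
  split=> [i j /val_inj /inj|i]; last exact/set_mem/valP.
  by rewrite !in_setT => /(_ isT isT) [].
have [[m Am]|Ainf] := pselect (finite_set A).
  rewrite (card_le_eql Am) card_le_II leqNgt; apply/negP => nm; apply: notle.
  by rewrite (card_le_eqr Am) card_le_II.
exfalso; apply: notle; apply: card_le_trans ((infiniteP _).1 Ainf).
exact: subset_card_le.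
Qed.

Lemma Seq_equiv_sym (R : realType) (X : metricType R) (r : nat -> R)
    (x y : nat -> X) : Seq_equiv r x y -> Seq_equiv r y x.
Proof.
by rewrite /Seq_equiv; under [in X in _ -> X]eq_fun do rewrite metric_sym.
Qed.

Lemma Seq_equiv_trans (R : realType) (X : metricType R) (r : nat -> R)
    (x y z : nat -> X) : (forall n, 0 < r n) ->
  Seq_equiv r x y -> Seq_equiv r y z -> Seq_equiv r x z.
Proof.
move=> r0 xy yz.
apply: (@squeeze_cvgr _ _ _ _ (fun=> 0)
  (fun n => mdist (x n) (y n) / r n + mdist (y n) (z n) / r n)).
- near=> n => /=; rewrite divr_ge0 ?mdist_ge0 ?(ltW (r0 _))//= -mulrDl.
  by rewrite ler_wpM2r ?invr_ge0 ?(ltW (r0 _)) ?metric_triangle.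
- exact: cvg_cst.
- by rewrite -[X in _ --> X]addr0; exact: cvgD.
Unshelve. all: by end_near. Qed.

(** A vertex is handled through a representative: distinct vertices are the
    classes of inequivalent sequences, so no class has to be manipulated
    afterwards. *)
Lemma card_vertices_leP (R : realType) (X : metricType R) (p : X)
    (r : nat -> R) (n : nat) : scaling_sequence r ->
  (vertices (pretangent_cluster p r) #<= `I_n)%card <->
  ~ exists x : 'I_n.+1 -> nat -> X, (forall i, Seq p r (x i)) /\
      forall i j, i != j -> ~ Seq_equiv r (x i) (x j).
Proof.
move=> [r0 _]; rewrite card_le_II_injP; split; apply: contra_not.
  move=> [x [xS xN]].
  exists (fun i => [set y | Seq p r y /\ Seq_equiv r (x i) y]); split.
    move=> i j eqij; apply: contrapT => /eqP ij; apply: (xN _ _ ij).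
    suff [] : [set y | Seq p r y /\ Seq_equiv r (x i) y] (x j) by [].
    rewrite eqij; split=> //; rewrite /Seq_equiv.
    under eq_fun do rewrite mdistxx mul0r.
    exact: cvg_cst.
  by move=> i; exists (x i).
move=> [f [finj /(_ _)/cid2-/all_sig2[x xS xf]]]; exists x; split=> // i j ij eqv.
move: ij; apply/negP; rewrite negbK; apply/eqP/finj; rewrite -!xf.
apply/seteqP; split=> y [yS yx]; split=> //.
  exact: Seq_equiv_trans (Seq_equiv_sym _ _ _ _ _ eqv) yx.
exact: Seq_equiv_trans eqv yx.
Qed.

(** A positive limit of the ratio forces the points to infinity, because r
    itself goes to infinity; for the limit 0 this fails. *)
Lemma Seq_of_ratio (R : realType) (X : metricType R) (p : X) (r : nat -> R)
    (x : nat -> X) (a : R) : scaling_sequence r -> 0 < a ->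
  mdist (x n) p / r n @[n --> \oo] --> a -> Seq p r x.
Proof.
move=> [r0 roo] a0 xa; split; last by apply/cvg_ex; exists a.
apply/cvgryPge => A.
have ha : 0 < a / 2 by rewrite divr_gt0.
near=> n.
have ratio_ge : a / 2 <= mdist (x n) p / r n.
  rewrite ltW//; near: n; apply: (cvgr_gt a xa).
  by rewrite ltr_pdivrMr// ltr_pMr// ltr1n.
have r_ge : A / (a / 2) <= r n by near: n; exact: (cvgry_ge _ _).
rewrite -[leRHS](@divfK _ (r n)) ?gt_eqF//.
rewrite ler_pdivrMr// in r_ge; apply: (le_trans r_ge).
by rewrite mulrC ler_wpM2r// ltW.
Unshelve. all: by end_near. Qed.

(** * Diameters and thin annuli *)

Lemma diam_ge0 (R : realType) (X : metricType R) (A : set X) :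
  (0 <= diam A)%E.
Proof. by apply: ereal_sup_ubound; left. Qed.

Lemma mdist_le_diam (R : realType) (X : metricType R) (A : set X) (x y : X) :
  A x -> A y -> ((mdist x y)%:E <= diam A)%E.
Proof. by move=> Ax Ay; apply: ereal_sup_ubound; right; exists x => //; exists y. Qed.

Lemma diam_le (R : realType) (X : metricType R) (A : set X) (c : R) :
  0 <= c -> (forall x y, A x -> A y -> mdist x y <= c) -> (diam A <= c%:E)%E.
Proof.
move=> c0 Ac; apply: ge_ereal_sup => _ [->/=|[x Ax [y Ay <-]]/=]; rewrite ?lee_fin//.
exact: Ac.
Qed.

Lemma cvge0_squeeze (R : realType) (T : Type) (F : set_system T) (FF : Filter F)
    (f : T -> \bar R) :
  (forall e : R, 0 < e -> \forall t \near F, (0 <= f t <= e%:E)%E) ->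
  f @ F --> 0%E.
Proof.
move=> H; apply/fine_cvgP; split.
  near=> t; have : (0 <= f t <= 1%:E)%E by near: t; exact: H.
  by move=> /andP[f0 f1]; rewrite ge0_fin_numE// (le_lt_trans f1)// ltry.
apply/cvgr0Pnorm_le => e e0; near=> t => /=.
have : (0 <= f t <= e%:E)%E by near: t; exact: H.
by case: (f t) => [s||] /andP[//]; rewrite !lee_fin => s0 se /=; rewrite ger0_norm.
Unshelve. all: by end_near. Qed.

Lemma cvge0_lt (R : realType) (T : Type) (F : set_system T) (FF : Filter F)
    (f : T -> \bar R) (e : R) : 0 < e ->
  f @ F --> 0%E -> \forall t \near F, (f t < e%:E)%E.
Proof.
move=> e0 /fine_cvgP[fin /cvgr0_norm_lt/(_ e e0) lte]; near=> t.
have ft : f t \is a fin_num by near: t.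
rewrite -(fineK ft) lte_fin ltr_normlW//.
by near: t.
Unshelve. all: by end_near. Qed.

(** The epsilon form of the double limit over annuli, stated on pairs of points
    which keeps suprema and extended reals out of the geometric arguments. *)
Definition thin_annuli (R : realType) (X : metricType R) (p : X) : Prop :=
  forall e : R, 0 < e -> exists2 k : R, 1 < k & \forall r \near +oo,
    forall x y, annulus p r k x -> annulus p r k y -> mdist x y <= e * r.

Lemma annulus_subset (R : realType) (X : metricType R) (p : X) (r k l : R) :
  0 < r -> 0 < k -> k <= l -> annulus p r k `<=` annulus p r l.
Proof.
move=> r0 k0 kl x /andP[rk xr]; have l0 := lt_le_trans k0 kl.
apply/andP; split; last by rewrite (le_trans xr)// ler_pM2l.
by rewrite (le_trans _ rk)// ler_pM2l// lef_pV2.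
Qed.

(** Annuli grow with k, so that a single good k settles all smaller ones;
    conversely a limsup below e is a bound by e near infinity. *)
Lemma thin_annuliP (R : realType) (X : metricType R) (p : X) :
  thin_annuli R X p <->
  limf_esup (fun r : R => diam (annulus p r k) * (r^-1)%:E)%E +oo_R
    @[k --> (1 : R)^'+] --> 0%E.
Proof.
split=> [thin|lim0 e e0].
  apply: cvge0_squeeze => e e0; have [l l1 thinl] := thin e e0.
  near=> k; apply/andP; split.
    apply: le_ereal_inf_tmp => _ [V Voo <-].
    have [r r0 Vr] := pinfty_ex_gt0 Voo.
    apply: (@le_trans _ _ (diam (annulus p r k) * (r^-1)%:E)%E).
      by rewrite mule_ge0 ?diam_ge0// lee_fin invr_ge0 ltW.
    by apply: ereal_sup_ubound; exists r.
  pose V := [set r : R | (diam (annulus p r k) * (r^-1)%:E <= e%:E)%E].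
  have Voo : +oo V.
    near=> r; have r0 : 0 < r by near: r; exact: nbhs_pinfty_gt.
    rewrite /V/= lee_pdivrMr//; apply: diam_le; first by rewrite mulr_ge0// ltW.
    have kl : annulus p r k `<=` annulus p r l.
      by apply: annulus_subset => //; [exact: lt_trans ltr01 _|exact: ltW].
    move=> x y /kl xl /kl yl; move: x y xl yl.
    by near: r.
  apply: (@le_trans _ _ (ereal_sup
    ((fun r => diam (annulus p r k) * (r^-1)%:E)%E @` V))).
    by apply: ereal_inf_lbound; exists V.
  by apply: ge_ereal_sup => _ [r Vr <-].
(* An infimum below e is witnessed by one neighbourhood of infinity. *)
have : \forall k \near (1 : R)^'+, (1 < k) /\
    (limf_esup (fun r : R => diam (annulus p r k) * (r^-1)%:E)%E +oo_R < e%:E)%E.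
  near=> k; split => //; near: k.
  exact: cvge0_lt.
move=> /filter_ex[k [k1 /ereal_inf_lt[_ [V Voo <-] supV]]].
exists k => //; near=> r; have r0 : 0 < r by near: r; exact: nbhs_pinfty_gt.
move=> x y xk yk; rewrite -lee_fin (le_trans (mdist_le_diam _ _ _ _ _ xk yk))//.
rewrite EFinM -lee_pdivrMr// (le_trans _ (ltW supV))//.
apply: ereal_sup_ubound; exists r => //.
by near: r.
Unshelve. all: by end_near. Qed.

(** The sphere of radius r lies in each annulus around r. *)
Lemma thin_annuli_sphere (R : realType) (X : metricType R) (p : X) :
  thin_annuli R X p ->
  (diam (sphere p r) * (r^-1)%:E)%E @[r --> +oo_R] --> 0%E.
Proof.
move=> thin; apply: cvge0_squeeze => e e0; have [k k1 think] := thin e e0.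
near=> r; have r0 : 0 < r by near: r; exact: nbhs_pinfty_gt.
rewrite mule_ge0 ?diam_ge0 ?lee_fin ?invr_ge0 ?(ltW r0)//=.
rewrite lee_pdivrMr//; apply: diam_le; first by rewrite mulr_ge0// ltW.
have sk : sphere p r `<=` annulus p r k.
  move=> x xr; apply/andP; rewrite xr; split.
    by rewrite ler_pdivrMr ?(lt_trans ltr01)// ler_pMr// ltW.
  by rewrite ler_pMr// ltW.
move=> x y /sk xk /sk yk; move: x y xk yk.
by near: r.
Unshelve. all: by end_near. Qed.

(** Both sequences are equivalent to the constant sequence p.  The latter is
    not in Seq(X, r), but the relation makes sense for all sequences. *)
Lemma Seq_equiv_of_ratio0 (R : realType) (X : metricType R) (p : X)
    (r : nat -> R) (x y : nat -> X) : (forall n, 0 < r n) ->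
  mdist (x n) p / r n @[n --> \oo] --> (0 : R) ->
  mdist (y n) p / r n @[n --> \oo] --> (0 : R) -> Seq_equiv r x y.
Proof.
move=> r0 x0 y0; apply: (@Seq_equiv_trans _ _ _ _ (fun=> p)) => //.
exact: Seq_equiv_sym.
Qed.

(** Up to any factor k > 1, both sequences eventually lie in the annulus of
    radius a r_n, whose diameter is at most (e / a) (a r_n). *)
Lemma Seq_equiv_of_thin (R : realType) (X : metricType R) (p : X)
    (r : nat -> R) (x y : nat -> X) (a : R) :
  thin_annuli R X p -> scaling_sequence r -> 0 < a ->
  mdist (x n) p / r n @[n --> \oo] --> a ->
  mdist (y n) p / r n @[n --> \oo] --> a -> Seq_equiv r x y.
Proof.
move=> thin [r0 roo] a0 xa ya; apply/cvgr0Pnorm_le => e e0.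
have [k k1 think] := thin (e / a) (divr_gt0 e0 a0).
have k0 : 0 < k := lt_trans ltr01 k1.
have in_annulus (z : nat -> X) : mdist (z n) p / r n @[n --> \oo] --> a ->
    \forall n \near \oo, annulus p (a * r n) k (z n).
  move=> za; near=> n; apply/andP; split.
    rewrite mulrAC -ler_pdivlMr// ltW//; near: n; apply: (cvgr_gt a za).
    by rewrite ltr_pdivrMr// ltr_pMr.
  rewrite mulrAC -ler_pdivrMr// ltW//; near: n; apply: (cvgr_lt a za).
  by rewrite ltr_pMr.
have aroo : a * r n @[n --> \oo] --> +oo.
  apply/cvgryPge => A; near=> n; rewrite mulrC -ler_pdivrMr//.
  by near: n; exact: (cvgry_ge roo).
near=> n; rewrite ger0_norm ?divr_ge0 ?mdist_ge0 ?(ltW (r0 _))//.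
rewrite ler_pdivrMr//.
have -> : e * r n = e / a * (a * r n) by rewrite mulrA divfK// gt_eqF.
have xn : annulus p (a * r n) k (x n) by near: n; exact: in_annulus.
have yn : annulus p (a * r n) k (y n) by near: n; exact: in_annulus.
move: (x n) (y n) xn yn; near: n.
exact: (aroo _ think).
Unshelve. all: by end_near. Qed.

(** A failure of thinness yields points x_m, y_m at distance more than e r_m
    in annuli that shrink to ratio 1.  Interleaving x and y in different ways
    produces arbitrarily many vertices. *)
Lemma thin_annuli_of_card (R : realType) (X : metricType R) (p : X) (n : nat) :
  (forall r : nat -> R, scaling_sequence r ->
     (vertices (pretangent_cluster p r) #<= `I_n)%card) ->
  thin_annuli R X p.
Proof.
move=> card_le e e0; apply: contrapT => nothin.
pose k m : R := 1 + harmonic m.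
have k1 m : 1 < k m by rewrite ltrDl harmonic_gt0.
have bad m : exists q : R * (X * X), [/\ m%:R < q.1,
    annulus p q.1 (k m) q.2.1, annulus p q.1 (k m) q.2.2 &
    e * q.1 < mdist q.2.1 q.2.2].
  apply: contrapT => nobad; apply: nothin; exists (k m) => //.
  exists m%:R; split=> // r mr x y xk yk; rewrite leNgt; apply/negP => exy.
  by apply: nobad; exists (r, (x, y)).
have [q qP] := choice bad.
pose r m := (q m).1; pose x m := (q m).2.1; pose y m := (q m).2.2.
have rm m : m%:R < r m by have [] := qP m.
have rscal : scaling_sequence r.
  split=> [m|]; first exact: le_lt_trans (rm m).
  apply: ger_cvgy cvgr_idn; near=> m; exact: ltW.
have [r0 _] := rscal.
have ratio1 (z : nat -> X) : (forall m, annulus p (r m) (k m) (z m)) ->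
    mdist (z m) p / r m @[m --> \oo] --> (1 : R).
  move=> zk; have kcvg : k m @[m --> \oo] --> (1 : R).
    rewrite -[X in _ --> X]addr0; apply: cvgD; first exact: cvg_cst.
    exact: cvg_harmonic.
  apply: (squeeze_cvgr _ (f := fun m => (k m)^-1) (h := k)) => //.
    near=> m; have /andP[kz zk'] := zk m.
    by rewrite ler_pdivlMr// ler_pdivrMr// mulrC kz mulrC zk'.
  by rewrite -[X in _ --> X]invr1; apply: cvgV => //; exact: oner_neq0.
(* z i and z j differ whenever m is congruent to i modulo n + 1, hence
   infinitely often. *)
pose z (i : 'I_n.+1) m := if (m %% n.+1 == i)%N then x m else y m.
apply: ((card_vertices_leP _ _ _ _ _ rscal).1 (card_le r rscal)); exists z; split.
  move=> i; apply: (Seq_of_ratio _ _ _ _ _ 1) => //; apply: ratio1 => m.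
  by rewrite /z; case: ifP => _; have [] := qP m.
move=> i j ij /cvgr0_norm_lt/(_ e e0)[N _ HN].
pose m := (N * n.+1 + i)%N.
have mi : (m %% n.+1)%N = i by rewrite /m modnMDl modn_small.
have /HN : (N <= m)%N by rewrite /m (leq_trans (leq_pmulr N (ltn0Sn n)))// leq_addr.
rewrite /= /z mi eqxx ifN; last by apply: contra ij.
have [_ _ _ exy] := qP m; rewrite ger0_norm ?divr_ge0 ?mdist_ge0 ?(ltW (r0 _))//.
by rewrite ltr_pdivrMr// ltNge (ltW exy).
Unshelve. all: by end_near. Qed.

(** * Bounds for F *)

Lemma card_ltn_pairs (n : nat) :
  #|[pred kl : 'I_n * 'I_n | (kl.1 < kl.2)%N]| = (n * (n - 1) %/ 2)%N.
Proof.
rewrite -sum1_card /= -(pair_big_dep xpredT (fun k l : 'I_n => (k < l)%N)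
  (fun _ _ => 1%N)) /=.
rewrite (exchange_big_dep xpredT)//= subn1 divn2 -bin2 -bin2_sum big_mkord.
apply: eq_bigr => l _; rewrite -(big_ord_widen n (fun=> 1%N))// ?sum1_card ?card_ord//.
exact: ltnW.
Qed.

Lemma mdist_le_max_dist (R : realType) (X : metricType R) (p : X) (n : nat)
    (x : 'I_n -> X) (k : 'I_n) : mdist (x k) p <= max_dist p x.
Proof. exact: (le_bigmax _ (fun k => mdist (x k) p)). Qed.

Lemma min_dist_le_mdist (R : realType) (X : metricType R) (p : X) (n : nat)
    (x : 'I_n -> X) (k : 'I_n) : min_dist p x <= mdist (x k) p.
Proof. exact: bigmin_le_cond. Qed.

(** The exponent n (n - 1) / 2 + 1 is the number of factors of the numerator,
    so each of them can be divided by the maximum. *)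
Lemma F_normalized (R : realType) (X : metricType R) (p : X) (n : nat)
    (x : 'I_n -> X) : 0 < max_dist p x ->
  F_ p x = min_dist p x / max_dist p x *
    \prod_(kl : 'I_n * 'I_n | (kl.1 < kl.2)%N)
       (mdist (x kl.1) (x kl.2) / max_dist p x).
Proof.
move=> max0; rewrite /F_ ifF; last first.
  apply/negbTE/negP => /forallP xp; move: max0; rewrite ltNge => /negP; apply.
  by apply: bigmax_le => // k _; rewrite (eqP (xp k)) mdistxx.
rewrite prodf_div prodr_const card_ltn_pairs pair_big_dep/= addn1 exprS invfM.
by rewrite mulrACA.
Qed.

(** Each of the factors of [F_normalized] is at least a / b. *)
Lemma F_ge (R : realType) (X : metricType R) (p : X) (n : nat)
    (x : 'I_n -> X) (a b : R) : (0 < n)%N -> 0 < a ->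
  (forall k, a <= mdist (x k) p <= b) ->
  (forall k l, k != l -> a <= mdist (x k) (x l)) ->
  (a / b) ^+ (n * (n - 1) %/ 2 + 1) <= F_ p x.
Proof.
move=> n0 a0 xab xa; pose k0 := Ordinal n0.
have /andP[ak0 kb0] := xab k0.
have b0 : 0 < b by rewrite (lt_le_trans a0)// (le_trans ak0).
have max0 : 0 < max_dist p x.
  by rewrite (lt_le_trans a0)// (le_trans ak0)// mdist_le_max_dist.
have maxb : max_dist p x <= b.
  by apply: bigmax_le => [|k _]; [exact: ltW|have /andP[] := xab k].
have amin : a <= min_dist p x.
  apply: le_bigmin => [|k _]; last by have /andP[] := xab k.
  by rewrite (le_trans ak0)// mdist_le_max_dist.
have quot (s : R) : a <= s -> a / b <= s / max_dist p x.
  by move=> as_; rewrite ler_pM ?invr_ge0 ?(ltW a0) ?(ltW b0)// lef_pV2.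
have ab0 : 0 <= a / b by rewrite divr_ge0 ?ltW.
rewrite F_normalized// addn1 exprS ler_pM ?exprn_ge0 ?quot//.
rewrite -card_ltn_pairs -prodr_const; apply: ler_prod => -[k l] /= kl.
by rewrite ab0 quot// xa//; apply: contraTneq kl => ->; rewrite inE/= ltnn.
Qed.

(** Every factor of [F_normalized] is at most 2 and the first one at most 1:
    as the product is at least e, none of them can be smaller than
    e / 2 ^ (number of pairs). *)
Lemma F_separation (R : realType) (X : metricType R) (p : X) (n : nat)
    (x : 'I_n -> X) (e : R) : 0 < e -> e <= F_ p x ->
  let c := e / 2 ^+ (n * (n - 1) %/ 2) * max_dist p x in
  [/\ 0 < max_dist p x, forall k, c <= mdist (x k) p &
      forall k l, k != l -> c <= mdist (x k) (x l)].
Proof.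
move=> e0 eF; set N := (n * (n - 1) %/ 2)%N.
have max0 : 0 < max_dist p x.
  rewrite ltNge; apply/negP => max_le0; move: eF; rewrite leNgt => /negP; apply.
  rewrite /F_ ifT//; apply/forallP => k; apply/eqP/mdist_positivity/eqP.
  by rewrite eq_le mdist_ge0 andbT (le_trans (mdist_le_max_dist _ _ _ _ _ _)).
have pow0 : 0 < 2 ^+ N :> R by rewrite exprn_gt0.
have fac k l : 0 <= mdist (x k) (x l) / max_dist p x <= 2.
  rewrite divr_ge0 ?mdist_ge0 ?(ltW max0)//= ler_pdivrMr//.
  rewrite (le_trans (metric_triangle _ p _))// mulr_natl mulr2n.
  by rewrite lerD ?mdist_le_max_dist// metric_sym mdist_le_max_dist.
have minmax : 0 <= min_dist p x / max_dist p x <= 1.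
  have minmax : min_dist p x <= max_dist p x by exact: bigmin_le_id.
  rewrite divr_ge0 ?(ltW max0)// ?ler_pdivrMr ?mul1r ?minmax//.
  by apply: le_bigmin => [|k _]; [exact: ltW|exact: mdist_ge0].
move: eF; rewrite F_normalized// => eF.
have prod_le : \prod_(kl : 'I_n * 'I_n | (kl.1 < kl.2)%N)
    (mdist (x kl.1) (x kl.2) / max_dist p x) <= 2 ^+ N.
  by rewrite /N -card_ltn_pairs -prodr_const; apply: ler_prod => -[k l] _.
split=> // [k|k l].
  rewrite -ler_pdivlMr// (le_trans _ (_ : min_dist p x / max_dist p x <= _))//.
    rewrite ler_pdivrMr// (le_trans eF)// ler_wpM2l//.
    by case/andP: minmax.
  by rewrite ler_pM2r ?invr_gt0// min_dist_le_mdist.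
wlog : k l / (k < l)%N => [H kl|kl _].
  have [/H->//|] := ltnP k l; rewrite leq_eqVlt => /orP[/eqP lk|/H].
    by move: kl; rewrite (val_inj lk) eqxx.
  by rewrite metric_sym; apply; rewrite eq_sym.
rewrite -ler_pdivlMr// ler_pdivrMr// (le_trans eF)//.
(* Isolate the factor of the pair (k, l) and bound the others by 2. *)
rewrite (bigD1 (k, l))//= mulrCA ler_wpM2l//; first by case/andP: (fac k l).
have -> : 2 ^+ N =
    2 * \prod_(kl : 'I_n * 'I_n | (kl.1 < kl.2)%N && (kl != (k, l))) (2 : R).
  by rewrite -[RHS](bigD1 (k, l))//= prodr_const card_ltn_pairs.
rewrite ler_pM//.
- by case/andP: minmax.
- by apply: prodr_ge0 => -[i j] _; case/andP: (fac i j).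
- by case/andP: minmax => _ /le_trans; apply; rewrite ler1n.
- by apply: ler_prod => -[i j] _.
Qed.

(** * Vertices from large values of F *)

Lemma increasing_seq_cvgy (f : nat -> nat) : increasing_seq f ->
  f n @[n --> \oo] --> \oo.
Proof.
move=> fincr; apply/cvgnyPge => N; exists N => // m /= /leq_trans; apply.
elim: m => // m IH; apply: leq_ltn_trans IH _.
by move/increasing_seqP : fincr; exact.
Qed.

(** Successive extractions: convergence of one sequence survives the
    extractions made for the others. *)
Lemma bolzano_weierstrass_family (R : realType) (n : nat)
    (u : 'I_n -> nat -> R) : (forall i, bounded_fun (u i)) ->
  exists2 f : nat -> nat, increasing_seq f & forall i, cvgn (u i \o f).
Proof.
elim: n u => [|n IH] u bu; first by exists id => // -[].
have [f fincr fcvg] := bolzano_weierstrass (bu ord0).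
have [|g gincr gcvg] := IH (fun i => u (lift ord0 i) \o f).
  move=> i; have [M [Mreal MB]] := bu (lift ord0 i).
  by exists M; split=> // x /MB{}MB m _ /=; exact: MB.
exists (f \o g); first by move=> a b /=; rewrite fincr -leEnat gincr.
move=> i; case: (unliftP ord0 i) => [j ->|->]; first exact: gcvg.
apply/cvg_ex; have [l fl] := (cvg_ex _).1 fcvg; exists l.
exact: (cvg_comp _ _ (increasing_seq_cvgy _ gincr) fl).
Qed.

(** The maxima of the tuples serve as the scaling sequence.  The tuples are
    chosen so far away that w_m, a fixed sequence going to infinity, is
    negligible compared to the m-th maximum: w then represents the vertex of
    ratio 0, the one that brings the number of vertices to n + 1. *)
Lemma F_small_of_card (R : realType) (X : metricType R) (p : X) (n : nat) :
  unbounded_space X -> (0 < n)%N ->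
  (forall r : nat -> R, scaling_sequence r ->
     (vertices (pretangent_cluster p r) #<= `I_n)%card) ->
  forall eps : R, 0 < eps -> exists2 M : R, 0 < M &
    forall x : 'I_n -> X, (forall i, M < mdist (x i) p) -> F_ p x < eps.
Proof.
move=> hX n0 card_le e e0; apply: contrapT => noM.
have [w wP] : {w : nat -> X & forall m, m%:R < mdist (w m) p}.
  apply: (@choice _ _ (fun m z => m%:R < mdist z p)) => m.
  apply: contrapT => now.
  have near_p z : mdist z p <= m%:R.
    by rewrite leNgt; apply/negP => mz; apply: now; exists z.
  have [a [b]] := hX (m%:R + m%:R); apply/negP; rewrite -leNgt.
  by rewrite (le_trans (metric_triangle _ p _))// lerD// metric_sym.
(* A maximum above B m gives d(w_m, p) <= maximum / (m + 1), and is itself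
   at least m. *)
pose B m := m.+1%:R * (mdist (w m) p + 1).
have B0 m : 0 < B m by rewrite mulr_gt0// ltr_wpDl// mdist_ge0.
have [x xP] : {x : nat -> 'I_n -> X & forall m,
    (forall k, B m < mdist (x m k) p) /\ e <= F_ p (x m)}.
  apply: (@choice _ _ (fun m (y : 'I_n -> X) =>
    (forall k, B m < mdist (y k) p) /\ e <= F_ p y)) => m.
  apply: contrapT => nox; apply: noM; exists (B m) => // x xB.
  by rewrite ltNge; apply/negP => ex; apply: nox; exists x.
pose c := e / 2 ^+ (n * (n - 1) %/ 2).
have c0 : 0 < c by rewrite divr_gt0// exprn_gt0.
pose b m := max_dist p (x m).
have sep m : [/\ 0 < b m, forall k, c * b m <= mdist (x m k) p &
    forall k l, k != l -> c * b m <= mdist (x m k) (x m l)].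
  by apply: F_separation => //; have [] := xP m.
have b0 m : 0 < b m by have [] := sep m.
have Bb m : B m < b m.
  have [/(_ (Ordinal n0)) Bx _] := xP m.
  exact: lt_le_trans Bx (mdist_le_max_dist _ _ _ _ _ _).
have [|f fincr fcvg] := bolzano_weierstrass_family _ _
    (fun k m => mdist (x m k) p / b m).
  move=> k; exists 1; split=> // s s1 m _ /=.
  rewrite ger0_norm ?divr_ge0 ?mdist_ge0 ?(ltW (b0 _))// (le_trans _ (ltW s1))//.
  by rewrite ler_pdivrMr// mul1r mdist_le_max_dist.
have foo := increasing_seq_cvgy _ fincr.
pose r := b \o f.
have r0 m : 0 < r m by exact: b0.
have rscal : scaling_sequence r.
  split=> //; suff boo : b m @[m --> \oo] --> +oo by exact: cvg_comp foo boo.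
  apply: ger_cvgy cvgr_idn; near=> m; rewrite (le_trans _ (ltW (Bb m)))//.
  by rewrite -[leLHS]mulr1 ler_pM// ?ler_nat// lerDr mdist_ge0.
pose y (k : 'I_n) m := x (f m) k; pose v := w \o f.
have v_ratio : mdist (v m) p / r m @[m --> \oo] --> (0 : R).
  suff wb : mdist (w m) p / b m @[m --> \oo] --> (0 : R) by exact: cvg_comp foo wb.
  apply: (@squeeze_cvgr _ _ _ _ (fun=> 0) harmonic).
  - near=> m => /=; rewrite divr_ge0 ?mdist_ge0 ?(ltW (b0 _))//= ler_pdivrMr//.
    rewrite mulrC ler_pdivlMr// (le_trans _ (ltW (Bb m)))// mulrC ler_wpM2l//.
    by rewrite lerDl.
  - exact: cvg_cst.
  - exact: cvg_harmonic.
have v_far : mdist (v m) p @[m --> \oo] --> +oo.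
  suff woo : mdist (w m) p @[m --> \oo] --> +oo by exact: cvg_comp foo woo.
  by apply: ger_cvgy cvgr_idn; near=> m; exact: ltW.
have y_ratio k : exists2 a : R, 0 < a & mdist (y k m) p / r m @[m --> \oo] --> a.
  have [a ya] := (cvg_ex _).1 (fcvg k); exists a => //.
  apply: (lt_le_trans c0); apply: (cvgr_to_ge ya); near=> m => /=.
  by rewrite ler_pdivlMr//; have [_ + _] := sep (f m); apply.
(* Otherwise y k would be equivalent to the constant sequence p, which says
   that its ratio tends to 0. *)
have y_v k : ~ Seq_equiv r (y k) v.
  move=> yv; have [a a0 ya] := y_ratio k.
  have yp : Seq_equiv r (y k) (fun=> p) by exact: Seq_equiv_trans yv v_ratio.
  by move: a0; rewrite (cvg_unique _ ya yp) ?ltxx//.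
have y_y k l : k != l -> ~ Seq_equiv r (y k) (y l).
  move=> kl /cvgr0_norm_lt/(_ c c0)[N _ /(_ N (leqnn N))] /=.
  rewrite ger0_norm ?divr_ge0 ?mdist_ge0 ?(ltW (r0 _))// ltr_pdivrMr//.
  by apply/negP; rewrite -leNgt; have [_ _] := sep (f N); apply.
apply: ((card_vertices_leP _ _ _ _ _ rscal).1 (card_le r rscal)).
exists (fun i => if unlift ord0 i is Some k then y k else v); split=> [i|i j].
  case: unliftP => [k _|_]; last by split=> //; apply/cvg_ex; exists 0.
  by have [a a0 ya] := y_ratio k; exact: Seq_of_ratio a0 ya.
case: unliftP => [k ->|->]; case: unliftP => [l ->|->]; last by rewrite eqxx.
- by move=> kl; apply: y_y; apply: contra_neq kl => ->.
- by move=> _; exact: y_v.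
- by move=> _ /Seq_equiv_sym; exact: y_v.
Unshelve. all: by end_near. Qed.

(** * Few vertices from small values of F *)

(** Thin annuli make the ratio injective on vertices, so n + 1 vertices would
    include n with distinct positive ratios, along which F is bounded below. *)
Lemma card_of_F_small (R : realType) (X : metricType R) (p : X) (n : nat)
    (r : nat -> R) : (0 < n)%N -> thin_annuli R X p ->
  (forall eps : R, 0 < eps -> exists2 M : R, 0 < M &
    forall x : 'I_n -> X, (forall i, M < mdist (x i) p) -> F_ p x < eps) ->
  scaling_sequence r ->
  (vertices (pretangent_cluster p r) #<= `I_n)%card.
Proof.
move=> n0 thin Fsmall rscal; have [r0 roo] := rscal.
apply/card_vertices_leP => // -[z [zS zN]].
have [a za] : {a : 'I_n.+1 -> R & forall i,
    mdist (z i m) p / r m @[m --> \oo] --> a i}.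
  apply: (@choice _ _ (fun i l => mdist (z i m) p / r m @[m --> \oo] --> l)).
  by move=> i; have [_ /cvg_ex] := zS i.
have a_ge0 i : 0 <= a i.
  apply: (cvgr_to_ge (za i)); near=> m.
  by rewrite divr_ge0 ?mdist_ge0 ?(ltW (r0 _)).
have a_inj i j : i != j -> a i != a j.
  move=> ij; apply/eqP => eqa; apply: (zN _ _ ij).
  have zaj := za j; rewrite -eqa in zaj.
  have := a_ge0 i; rewrite le_eqVlt => /orP[/eqP ai0|ai0].
    by apply: (Seq_equiv_of_ratio0 _ _ p) => //; rewrite ai0.
  exact: Seq_equiv_of_thin thin rscal ai0 (za i) zaj.
(* Drop the sequence of ratio 0 if there is one, any sequence otherwise. *)
have [i0 i0P] : exists i0, forall k, 0 < a (lift i0 k).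
  have [[i0 ai0]|nozero] := pselect (exists i, a i = 0).
    exists i0 => k; rewrite lt_neqAle a_ge0 andbT -ai0.
    exact/a_inj/neq_lift.
  exists ord0 => k; rewrite lt_neqAle a_ge0 andbT; apply/eqP => ak.
  by apply: nozero; exists (lift ord0 k).
pose x k := z (lift i0 k); pose s k := a (lift i0 k).
have s_inj k l : k != l -> 0 < `|s k - s l|.
  by move=> kl; rewrite normr_gt0 subr_eq0 a_inj// (inj_eq lift_inj).
(* All ratios lie in ]c, b[ and are more than c apart. *)
have c_lt_s : \forall c \near (0 : R)^'+, forall k, c < s k.
  by apply: filter_forall => k; exact/nbhs_right_lt/i0P.
have c_lt_gap : \forall c \near (0 : R)^'+, forall kl : 'I_n * 'I_n,
    kl.1 != kl.2 -> c < `|s kl.1 - s kl.2|.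
  apply: filter_forall => -[k l] /=; have [->|kl] := eqVneq k l; first exact: nearW.
  by apply: filterS (nbhs_right_lt (s_inj _ _ kl)) => c.
have c_gt0 : \forall c \near (0 : R)^'+, 0 < c by exact: nbhs_right_gt.
have [c [c0 [cs cgap]]] := filter_ex (filterI c_gt0 (filterI c_lt_s c_lt_gap)).
have : \forall b \near +oo, forall k, s k < b.
  by apply: filter_forall => k; exact/nbhs_pinfty_gt/num_real.
move=> /filter_ex[b bP].
pose k0 := Ordinal n0; have b0 : 0 < b by rewrite (lt_trans c0)// (lt_trans (cs k0)).
have eps0 : 0 < (c / b) ^+ (n * (n - 1) %/ 2 + 1) by rewrite exprn_gt0// divr_gt0.
have [M M0 FM] := Fsmall _ eps0.
have far_ev : \forall m \near \oo, forall k, M < mdist (x k m) p.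
  apply: filter_forall => k; have [xoo _] := zS (lift i0 k).
  exact: cvgry_gt.
have ratio_ev : \forall m \near \oo, forall k,
    c * r m <= mdist (x k m) p <= b * r m.
  apply: filter_forall => k; near=> m; apply/andP; split.
    rewrite -ler_pdivlMr// ltW//; near: m; apply: (cvgr_gt _ (za _)); exact: cs.
  rewrite -ler_pdivrMr// ltW//; near: m; apply: (cvgr_lt _ (za _)); exact: bP.
have gap_ev : \forall m \near \oo, forall kl : 'I_n * 'I_n,
    kl.1 != kl.2 -> c * r m <= mdist (x kl.1 m) (x kl.2 m).
  apply: filter_forall => -[k l] /=.
  have [->|kl] := eqVneq k l; first exact: nearW.
  near=> m => _; rewrite -ler_pdivlMr//.
  apply: (@le_trans _ _ `|mdist (x k m) p / r m - mdist (x l m) p / r m|).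
    rewrite ltW//; near: m; apply: (cvgr_gt `|s k - s l|).
      by apply: cvg_norm; apply: cvgB; exact: za.
    exact: (cgap (k, l)).
  rewrite -mulrBl normrM [`|_^-1|]gtr0_norm ?invr_gt0// ler_pM2r ?invr_gt0//.
  rewrite ler_norml lerBlDr metric_triangle andbT lerNl opprB lerBlDr.
  by rewrite [mdist (x k m) (x l m)]metric_sym metric_triangle.
have [m [xM [xb xx]]] := filter_ex (filterI far_ev (filterI ratio_ev gap_ev)).
have := FM (fun k => x k m) xM; apply/negP; rewrite -leNgt.
have -> : c / b = c * r m / (b * r m).
  by rewrite -mulf_div divff ?mulr1// gt_eqF.
by apply: F_ge => [||k|k l kl]//; [rewrite mulr_gt0|exact: (xx (k, l))].
Unshelve. all: by end_near. Qed.

Theorem theorem3p1 (R : realType) (X : metricType R) (p : X) (n : nat)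
    (hX : unbounded_space X) (hn : (2 <= n)%N) :
  (forall r : nat -> R, scaling_sequence r ->
     (vertices (pretangent_cluster p r) #<= `I_n)%card)
  <->
  [/\ forall eps : R, 0 < eps -> exists2 M : R, 0 < M &
        forall x : 'I_n -> X, (forall i, M < mdist (x i) p) -> F_ p x < eps,
      limf_esup (fun r : R => diam (annulus p r k) * (r^-1)%:E)%E +oo_R
        @[k --> (1 : R)^'+] --> 0%E
    & (diam (sphere p r) * (r^-1)%:E)%E @[r --> +oo_R] --> 0%E].
Proof.
have n0 : (0 < n)%N by exact: ltnW.
split=> [card_le|[Fsmall annuli _] r rscal].
  have thin := thin_annuli_of_card _ _ _ _ card_le.
  split; [exact: F_small_of_card|exact/thin_annuliP|exact: thin_annuli_sphere].
by apply: card_of_F_small => //; exact/thin_annuliP.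
Qed.
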